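(* Let $\mu$ be a non-atomic Borel probability measure on $[0,1]$. Let $\lambda_{N,0}<\lambda_{N,1}<\lambda_{N,2}<\cdots$ be the Neumann eigenvalues of $-\frac{d}{d\mu}\frac{d}{dx}$. Then the $\lambda_{N,m}$, $m\in\mathbb{N}_0$, are precisely the squares of the non-negative zeros of the function $$\sin_\mu^N(z):=\sum_{n=0}^\infty(-1)^n\,p_{2n+1}\,z^{2n+1},\qquad z\in\mathbb{R},$$ where $p_n:=p_n(1)$. The corresponding eigenfunctions $f_{N,m}$ are given by $$f_{N,m}(x):=c_{\lambda,\mu}\bigl(\sqrt{\lambda_{N,m}},x\bigr)=\sum_{n=0}^\infty(-1)^n\,\lambda_{N,m}^n\,p_{2n}(x),\qquad x\in[0,1],$$ that is, $f_{N,m}$ is an eigenfunction for the eigenvalue $\lambda_{N,m}$.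
   Context: Derivatives with respect to a measure: for a non-atomic Borel probability measure $\nu$ on $[0,1]$ and $f\colon[0,1]\to\mathbb{R}$, a function $h\in L_2([0,1],\nu)$ is the $\nu$-derivative of $f$, written $\frac{df}{d\nu}$, if $f(x)=f(0)+\int_0^x h\,d\nu$ for all $x\in[0,1]$ (it is unique in $L_2(\nu)$). $H^1(\nu)$ is the space of functions possessing a $\nu$-derivative; such functions are continuous. For the Lebesgue measure the derivative is written $f'$ or $\frac{df}{dx}$. $H^2(\lambda,\mu)$, where $\lambda$ as an index denotes Lebesgue measure on $[0,1]$, is the space of all $f$ possessing a Lebesgue derivative $f'$ (that is, $f'$ is square-integrable with respect to Lebesgue measure and $f(x)=f(0)+\int_0^x f'(t)\,dt$ for all $x\in[0,1]$) that belongs to $H^1(\mu)$ (so $f'$ is taken to be the continuous representative). For $f\in H^2(\lambda,\mu)$ put $\Delta_\mu f=\frac{d}{d\mu}f'$. A Neumann eigenvalue is a real number $\Lambda$ such that there is a non-zero $f\in H^2(\lambda,\mu)$ (eigenfunction) with $\frac{d}{d\mu}f'=-\Lambda f$ and $f'(0)=f'(1)=0$. It is well known that the Neumann eigenvalues form a strictly increasing sequence $0=\lambda_{N,0}<\lambda_{N,1}<\cdots$ tending to infinity. Eigenfunctions are only determined up to a multiplicative constant. Functions $p_n$: $p_0(x)=1$ and, for $n\in\mathbb{N}=\{1,2,\dots\}$ and $x\in[0,1]$, $p_n(x)=\int_0^x p_{n-1}(t)\,d\mu(t)$ if $n$ is odd, $p_n(x)=\int_0^x p_{n-1}(t)\,dt$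 if $n$ is even. For $z\in\mathbb{R}$, $x\in[0,1]$: $c_{\lambda,\mu}(z,x)=\sum_{n=0}^\infty(-1)^n z^{2n}p_{2n}(x)$. (All series converge absolutely.) *)

(* Defs.v *)
From mathcomp Require Export all_boot all_order all_algebra.
From mathcomp Require Export all_classical all_reals all_analysis.

Set Implicit Arguments.
Unset Strict Implicit.
Unset Printing Implicit Defensive.
Import Order.TTheory GRing.Theory Num.Theory.
Import numFieldNormedType.Exports.

Local Open Scope classical_set_scope.
Local Open Scope ring_scope.

(* Functions on [0, 1] are represented by total functions R -> R of which only
   the values on [0, 1] matter. Measures on [0, 1] are represented by Borel
   measures on R; the Lebesgue measure is only ever used inside [0, 1]. *)

Section KreinFeller.
Context {R : realType}.
Implicit Types (f g h : R -> R) (L x z : R).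

Definition L2_01 (nu : {measure set (measurableTypeR R) -> \bar R}) h : Prop :=
  measurable_fun `[0 : R, 1] h /\
  nu.-integrable `[0 : R, 1] (fun x => (h x ^+ 2)%:E).

(* "h is a version of df/dnu" *)
Definition is_mderive (nu : {measure set (measurableTypeR R) -> \bar R}) f h :
    Prop :=
  L2_01 nu h /\
  forall x, x \in `[0, 1] -> f x = f 0 + \int[nu]_(t in `[0, x]) h t.

Variable mu : probability (measurableTypeR R) R.

(* For functions f and u on [0, 1]: f is in H^2(lambda, mu), with g the
   representative of f' that lies in H^1(mu), and d/dmu f' = u in L_2(mu). The
   identity defining [is_mderive mu g h] makes g continuous on [0, 1], since mu
   has no atoms. *)
Definition is_mu_laplacian f g u : Prop :=
  is_mderive lebesgue_measure f g /\
  exists2 h, is_mderive mu g h &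
    {ae mu, forall x, x \in `[0, 1] -> h x = u x}.

Definition neumann_eigenfunction L f : Prop :=
  (exists2 x, x \in `[0, 1] & f x != 0) /\
  exists2 g, is_mu_laplacian f g (fun x => - L * f x) & g 0 = 0 /\ g 1 = 0.

Definition neumann_eigenvalue L : Prop := exists f, neumann_eigenfunction L f.

(* lam is the increasing enumeration (lambda_{N,m})_m of all the Neumann
   eigenvalues. *)
Definition neumann_sequence (lam : nat -> R) : Prop :=
  {homo lam : m n / (m < n)%N >-> m < n} /\
  range lam = [set L | neumann_eigenvalue L].

Fixpoint p_ (n : nat) x : R :=
  if n is n'.+1 then
    if odd n then \int[mu]_(t in `[0, x]) p_ n' t
    else \int[lebesgue_measure]_(t in `[0, x]) p_ n' t
  else 1.

(* The two series below converge absolutely, so that [limn] is a genuine sum. *)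
Definition c_lambda_mu z x : R :=
  limn (series (fun n => (-1) ^+ n * z ^+ (2 * n) * p_ (2 * n) x)).

Definition sinN z : R :=
  limn (series (fun n => (-1) ^+ n * p_ (2 * n).+1 1 * z ^+ (2 * n).+1)).

End KreinFeller.

(* Main.v *)
Require Import Defs.
From mathcomp Require Import measurable_realfun ring lra.

(* Put C_L = sum_n (-L)^n p_{2n} and S_L = sum_n (-L)^n p_{2n+1}. Since
   p_{2n}(x) and p_{2n+1}(x) are at most x^n / n!, the series may be integrated
   termwise: S_L = \int C_L dmu and C_L = 1 - L \int S_L dx. Hence C_L satisfies
   the eigenvalue equation with (C_L)' = -L S_L and (C_L)'(0) = 0, and it is a
   Neumann eigenfunction as soon as L S_L(1) = 0. Conversely, if f is an
   eigenfunction then f - f(0) C_L is a fixed point of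
   u |-> -L \int \int u dmu dx, hence 0 by iteration; so f(0) <> 0 and
   L S_L(1) = 0. For L < 0 all terms of S_L(1) are nonnegative and the first one
   is 1, so eigenvalues are nonnegative, and z S_{z^2}(1) is the sine function. *)

Set Implicit Arguments.
Unset Strict Implicit.
Unset Printing Implicit Defensive.
Import Order.TTheory GRing.Theory Num.Theory.
Import numFieldNormedType.Exports.

Local Open Scope classical_set_scope.
Local Open Scope ring_scope.

(** * Integration over subintervals [0, x] for a measure of mass 1 on [0, 1] *)

Section UnitInterval.
Context {R : realType} (nu : {measure set (measurableTypeR R) -> \bar R}).
Hypothesis nu_01 : nu `[0 : R, 1]%classic = 1%E.
Implicit Types (f h : R -> R) (x M : R).

Lemma subset_itv01 x : x \in `[0, 1] -> `[0, x]%classic `<=` `[0 : R, 1]%classic.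
Proof.
by rewrite in_itv/= => /andP[_ x1]; apply: subset_itvl; rewrite bnd_simp.
Qed.

Lemma bounded_integrable01 h M : measurable_fun `[0 : R, 1] h ->
  (forall x, x \in `[0, 1] -> `|h x| <= M) ->
  nu.-integrable `[0 : R, 1] (EFin \o h).
Proof.
move=> mh hM; apply: measurable_bounded_integrable => //; first by rewrite nu_01 ltry.
exists M; split; rewrite ?num_real// => y My z z01.
exact: le_trans (hM _ z01) (ltW My).
Qed.

Lemma integrable_itv0 h x : x \in `[0, 1] ->
  nu.-integrable `[0 : R, 1] (EFin \o h) -> nu.-integrable `[0, x] (EFin \o h).
Proof. by move=> x01; apply: integrableS => //; exact: subset_itv01. Qed.

(** From [(|h| - 1) ^+ 2 >= 0] one gets [|h| <= 1 + h ^+ 2], and the constant 1 is integrable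
    because [nu] has finite mass on [0, 1]. *)
Lemma L2_01_integrable h : L2_01 nu h -> nu.-integrable `[0 : R, 1] (EFin \o h).
Proof.
move=> [mh h2].
have i1 : nu.-integrable `[0 : R, 1] (EFin \o cst 1).
  by apply: (@bounded_integrable01 _ 1) => // x _; rewrite normr1.
apply: (le_integrable _ _ _ (integrableD _ i1 h2)) => //.
  exact/measurable_EFinP.
move=> x _ /=; rewrite lee_fin [leRHS]ger0_norm ?addr_ge0 ?sqr_ge0//.
have := sqr_ge0 (`|h x| - 1); rewrite -[h x ^+ 2]real_normK ?num_real//.
have := normr_ge0 (h x); nra.
Qed.

(** The bound is uniform in [x]: a primitive with respect to one measure is thus bounded, so it can
    be integrated against the other one. *)
Lemma le_normr_Rintegral01 h x : x \in `[0, 1] ->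
  nu.-integrable `[0 : R, 1] (EFin \o h) ->
  `|\int[nu]_(t in `[0, x]) h t| <= \int[nu]_(t in `[0, 1]) `|h t|.
Proof.
move=> x01 ih; have ix := integrable_itv0 x01 ih.
rewrite (le_trans (le_normr_Rintegral _ ix))// /Rintegral fine_le//.
- by apply: integrable_fin_num => //; exact: integrable_norm ix.
- by apply: integrable_fin_num => //; exact: integrable_norm ih.
apply: ge0_subset_integral => //; last exact: subset_itv01.
apply/measurable_EFinP/measurableT_comp => //.
by apply/measurable_EFinP; exact: measurable_int ih.
Qed.

(** The primitive of a nonnegative function is monotone, hence Borel; the general case follows by
    splitting [h] into positive and negative parts. *)
Lemma measurable_Rintegral_itv0 h : nu.-integrable `[0 : R, 1] (EFin \o h) ->
  measurable_fun `[0 : R, 1] (fun x => \int[nu]_(t in `[0, x]) h t).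
Proof.
wlog h0 : h / forall x, 0 <= h x => [ge0_case ih|].
  have ip : nu.-integrable `[0 : R, 1] (EFin \o h^\+) by exact: integrable_funrpos.
  have iN : nu.-integrable `[0 : R, 1] (EFin \o h^\-) by exact: integrable_funrneg.
  apply: (eq_measurable_fun (fun x =>
      \int[nu]_(t in `[0, x]) (h^\+ t) - \int[nu]_(t in `[0, x]) (h^\- t))).
    move=> x /[!inE] x01.
    rewrite -RintegralB//; [|exact: integrable_itv0..].
    by apply: eq_Rintegral => t _; rewrite -[in RHS](funrposBneg h).
  by apply: measurable_funB; apply: ge0_case => // x; rewrite ?funrpos_ge0 ?funrneg_ge0.
move=> ih.
have ih' : nu.-integrable setT (EFin \o (h \_ `[0 : R, 1])).
  rewrite -restrict_EFin; apply/(integrable_restrict nu _ measurableT) => //.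
  by rewrite setTI.
have h'0 y : 0 <= (h \_ `[0 : R, 1]) y by rewrite patchE; case: ifP.
(* Extending h by 0 outside [0, 1] makes the primitive monotone on all of R. *)
apply: (eq_measurable_fun (fun x =>
    \int[nu]_(t in `[0, x]) ((h \_ `[0 : R, 1]) t))).
  move=> x /[!inE] x01; apply: eq_Rintegral => t /[!inE] tx.
  by rewrite patchE mem_set//; exact: subset_itv01 tx.
apply: nondecreasing_measurable => // x y xy.
have fin z : (\int[nu]_(t in `[0%R, z]) ((h \_ `[0 : R, 1]) t)%:E \is a fin_num)%E.
  by apply: integrable_fin_num => //; apply: integrableS ih'.
rewrite /Rintegral fine_le// ge0_subset_integral//.
- by apply: measurable_funTS; exact: measurable_int ih'.
- by move=> z _; rewrite lee_fin.
- by apply: subset_itvl; rewrite bnd_simp.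
Qed.

End UnitInterval.

(** * Real series dominated by a convergent series *)

Section DominatedSeries.
Context {R : realType}.
Variables u b : R ^nat.
Hypothesis u_le_b : forall n, `|u n| <= b n.
Hypothesis cvg_b : cvgn (series b).

Lemma dominated_cvg_series : cvgn (series u).
Proof.
apply: normed_cvg; apply: series_le_cvg cvg_b => // n; first exact: normr_ge0.
exact: le_trans (normr_ge0 _) (u_le_b n).
Qed.

(** The right-hand side does not depend on [n]; it serves as the constant majorant for dominated
    convergence. *)
Lemma dominated_series_le n : `|series u n| <= limn (series b).
Proof.
apply: (@le_trans _ _ (series b n)).
  by apply: le_trans (ler_norm_sum _ _ _) _; exact: ler_sum.
apply: nondecreasing_cvgn_le => //; apply/nondecreasing_seqP => m.
by rewrite seriesSr lerDl (le_trans (normr_ge0 _) (u_le_b m)).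
Qed.

End DominatedSeries.

(** * Bounds for primitives by the exponential terms x^n / n! *)

Section IntegralBounds.
Context {R : realType}.
Implicit Types (h : R -> R) (x y M : R).

Lemma le_exp_coeff n x y : 0 <= x -> x <= y -> exp_coeff x n <= exp_coeff y n.
Proof.
move=> x0 xy; rewrite /exp_coeff/= ler_pM2r ?invr_gt0 ?ltr0n ?fact_gt0//.
by rewrite lerXn2r ?nnegrE// (le_trans x0).
Qed.

Lemma measurable_exp_coeff (D : set R) n : measurable_fun D (fun x : R => exp_coeff x n).
Proof.
apply: measurable_funM => //; exact: measurable_funX.
Qed.

#[global] Instance is_derive_exp_coeff n x :
  is_derive x 1 (fun t : R => exp_coeff t n.+1) (exp_coeff x n).
Proof.
rewrite /exp_coeff/=.
have -> : (fun t : R => t ^+ n.+1 / n.+1`!%:R) =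
    n.+1`!%:R^-1 *: ((@id R) ^+ n.+1).
  by apply/funext => t; rewrite !fctE [LHS]mulrC.
have := is_deriveZ (n.+1`!%:R^-1 : R)
  (is_deriveX n.+1 (@is_derive_id _ _ x (1 : R))).
congr is_derive; rewrite factS natrM invfM /GRing.scale/= mulr1.
have n0 : (n.+1%:R : R) != 0 by rewrite pnatr_eq0.
have m0 : (n`!%:R : R) != 0 by rewrite pnatr_eq0 -lt0n fact_gt0.
by field; rewrite m0 nat1r.
Qed.

Lemma Rintegral_exp_coeff x n : 0 <= x ->
  \int[lebesgue_measure]_(t in `[0, x]) exp_coeff t n = exp_coeff x n.+1.
Proof.
(* The degenerate interval [0, 0] is treated apart; the fundamental theorem of calculus is applied
   for [0 < x]. *)
rewrite le_eqVlt => /predU1P[<-|x0].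
  by rewrite set_itv1 Rintegral_set1 /exp_coeff/= expr0n mul0r.
have cE m : continuous (fun t : R => exp_coeff t m).
  move=> y; rewrite /exp_coeff/=; apply: cvgMl; exact: exprn_continuous.
rewrite /Rintegral (@continuous_FTC2 _ _ (fun t => exp_coeff t n.+1))//.
- by rewrite -EFinB/= [X in _ - X](_ : _ = 0) ?subr0// /exp_coeff/= expr0n mul0r.
- exact: continuous_subspaceT.
- split=> //.
  + by apply: cvg_at_right_filter; exact: cE.
  + by apply: cvg_at_left_filter; exact: cE.
- by move=> y _; rewrite derive1E derive_val.
Qed.

Lemma lebesgue_measure_itv01 :
  (lebesgue_measure : {measure set (measurableTypeR R) -> \bar R})
    `[0 : R, 1]%classic = 1%E.
Proof.
apply: etrans (lebesgue_measure_itv `[0 : R, 1]) _.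
by rewrite /= lte_fin ltr01 oppr0 adde0.
Qed.

(** On [0, x] the integrand is at most its bound at [x], and [0, x] has mass at most 1. For such a
    general [nu] the degree [n] stays the same. *)
Lemma Rintegral_itv0_exp_coeff_le 
    (nu : {measure set (measurableTypeR R) -> \bar R}) h x M n :
  nu `[0 : R, 1]%classic = 1%E -> x \in `[0, 1] -> 0 <= M ->
  nu.-integrable `[0 : R, 1] (EFin \o h) ->
  (forall t, t \in `[0, 1] -> `|h t| <= M * exp_coeff t n) ->
  `|\int[nu]_(t in `[0, x]) h t| <= M * exp_coeff x n.
Proof.
move=> nu1 x01 M0 ih hM.
have /andP[x0 x1] : 0 <= x <= 1 by rewrite in_itv/= in x01.
have ix := integrable_itv0 x01 ih.
have nux : (nu `[0%R, x]%classic <= 1)%E.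
  by rewrite -nu1; apply: le_measure; rewrite ?inE//; exact: subset_itv01.
have nuxfin : nu `[0%R, x]%classic \is a fin_num.
  by rewrite ge0_fin_numE// (le_lt_trans nux)// ltry.
apply: le_trans (le_normr_Rintegral _ ix) _ => //.
have E0 : 0 <= M * exp_coeff x n by rewrite mulr_ge0// exp_coeff_ge0.
apply: (@le_trans _ _ (\int[nu]_(t in `[0, x]) (M * exp_coeff x n))).
  apply: le_Rintegral => //.
  - exact: (integrable_norm ix).
  - apply: (@integrable_itv0 _ nu (cst (M * exp_coeff x n))) => //.
    apply: (@bounded_integrable01 _ nu nu1 _ (M * exp_coeff x n)) => // t _.
    by rewrite ger0_norm.
  - move=> t /= t0x; have /andP[t0 tx] : 0 <= t <= x by rewrite in_itv/= in t0x.
    apply: le_trans (hM _ _) _; first by rewrite in_itv/= t0 (le_trans tx).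
    by rewrite ler_wpM2l// le_exp_coeff.
rewrite Rintegral_cst//= ler_piMr//.
by rewrite -lee_fin fineK.
Qed.

(** Here the bound itself is integrated, which raises the degree by one. All factorial decay in the
    proof comes from this gain. *)
Lemma lebesgue_itv0_exp_coeff_le h x M n : x \in `[0, 1] ->
  lebesgue_measure.-integrable `[0 : R, 1] (EFin \o h) ->
  (forall t, t \in `[0, 1] -> `|h t| <= M * exp_coeff t n) ->
  `|\int[lebesgue_measure]_(t in `[0, x]) h t| <= M * exp_coeff x n.+1.
Proof.
move=> x01 ih hM.
have /andP[x0 x1] : 0 <= x <= 1 by rewrite in_itv/= in x01.
have ix := integrable_itv0 x01 ih.
have iE : lebesgue_measure.-integrable `[0, x]
    (EFin \o (fun t : R => exp_coeff t n)).
  apply: (@integrable_itv0 _ lebesgue_measure (fun t : R => exp_coeff t n)) => //.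
  apply: (@bounded_integrable01 _ lebesgue_measure lebesgue_measure_itv01 _
    (exp_coeff 1 n)).
    exact: measurable_exp_coeff.
  move=> t; rewrite in_itv/= => /andP[t0 t1].
  by rewrite ger0_norm ?exp_coeff_ge0// le_exp_coeff.
apply: le_trans (le_normr_Rintegral _ ix) _ => //.
rewrite -Rintegral_exp_coeff// -RintegralZl//.
apply: le_Rintegral => //.
- exact: (integrable_norm ix).
- exact: (integrableZl _ M iE).
- move=> t /= t0x; have /andP[t0 tx] : 0 <= t <= x by rewrite in_itv/= in t0x.
  by rewrite hM// in_itv/= t0 (le_trans tx).
Qed.

End IntegralBounds.

(** * Termwise integration of dominated series of functions *)

Section SeriesIntegral.
Context {R : realType} (nu : {measure set (measurableTypeR R) -> \bar R}).
Hypothesis nu_01 : nu `[0 : R, 1]%classic = 1%E.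
Variables (a : nat -> R -> R) (b : R ^nat).
Hypothesis measurable_a : forall n, measurable_fun `[0 : R, 1] (a n).
Hypothesis a_le_b : forall n t, t \in `[0, 1] -> `|a n t| <= b n.
Hypothesis cvg_b : cvgn (series b).

Lemma measurable_limn_series :
  measurable_fun `[0 : R, 1] (fun t => limn (series (a ^~ t))).
Proof.
apply: (@measurable_fun_cvg _ _ _ _ (fun n t => series (a ^~ t) n)).
  by move=> n; apply: measurable_sum.
by move=> t t01; apply: dominated_cvg_series cvg_b => n; exact: a_le_b.
Qed.

Lemma limn_series_le t : t \in `[0, 1] ->
  `|limn (series (a ^~ t))| <= limn (series b).
Proof.
move=> t01.
have cvg_a : cvgn (series (a ^~ t)).
  by apply: dominated_cvg_series cvg_b => n; exact: a_le_b.
rewrite -lim_norm//; apply: limr_le; first exact: is_cvg_norm.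
by near=> n; apply: dominated_series_le => // k; exact: a_le_b.
Unshelve. all: by end_near. Qed.

(** Dominated convergence for the partial sums, all bounded by the constant [limn (series b)], which
    is integrable since [nu] has mass 1 on [0, 1]. *)
Lemma cvg_series_Rintegral x : x \in `[0, 1] ->
  series (fun n => \int[nu]_(t in `[0, x]) a n t) @ \oo -->
  \int[nu]_(t in `[0, x]) limn (series (a ^~ t)).
Proof.
move=> x01.
have ia n : nu.-integrable `[0 : R, 1] (EFin \o a n).
  by apply: (bounded_integrable01 nu_01) => // t; exact: a_le_b.
have iS n : nu.-integrable `[0 : R, 1] (EFin \o (fun t => series (a ^~ t) n)).
  apply: (@bounded_integrable01 _ _ nu_01 _ (limn (series b))).
    exact: measurable_sum.
  by move=> t t01; apply: dominated_series_le => // k; exact: a_le_b.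
have -> : series (fun n => \int[nu]_(t in `[0, x]) a n t) =
    (fun n => \int[nu]_(t in `[0, x]) series (a ^~ t) n).
  apply/funext; elim=> [|n IHn].
    rewrite /series/= big_nil; under eq_Rintegral do rewrite big_nil.
    by rewrite Rintegral_cst// mul0r.
  under [RHS]eq_Rintegral do rewrite seriesSr.
  by rewrite seriesSr IHn RintegralD//; exact: integrable_itv0.
have iL : nu.-integrable `[0, x] (EFin \o (fun t => limn (series (a ^~ t)))).
  apply: integrable_itv0 => //.
  apply: (@bounded_integrable01 _ _ nu_01 _ (limn (series b))).
    exact: measurable_limn_series.
  exact: limn_series_le.
apply: fine_cvg; rewrite fineK; last exact: integrable_fin_num.
apply: (@dominated_cvg _ _ _ _ _ _ _ _ (cst (limn (series b))%:E)) => //.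
- by move=> n; exact: measurable_int (integrable_itv0 x01 (iS n)).
- move=> t tx; apply: cvg_EFin; first exact: nearW.
  by apply: dominated_cvg_series cvg_b => n; apply: a_le_b; exact: subset_itv01 tx.
- apply: (@integrable_itv0 _ nu (cst (limn (series b)))) => //.
  exact: (@bounded_integrable01 _ _ nu_01 _ `|limn (series b)|).
- move=> n t tx; rewrite lee_fin; apply: dominated_series_le => // k; apply: a_le_b.
  exact: subset_itv01 tx.
Qed.

End SeriesIntegral.

(** * The iterated integrals [p_] and their factorial bounds *)

Section NeumannEigenvalues.
Context {R : realType} (mu : probability (measurableTypeR R) R).
Hypothesis mu_01 : mu `[0 : R, 1]%classic = 1%E.
Hypothesis mu_nonatomic : forall x : R, mu [set x] = 0%E.
Implicit Types (f u : R -> R) (L M x z : R).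

Lemma itv01_0 : (0 : R) \in `[0, 1]. Proof. by rewrite in_itv/= lexx ler01. Qed.
Lemma itv01_1 : (1 : R) \in `[0, 1]. Proof. by rewrite in_itv/= lexx ler01. Qed.

Lemma p_oddE n x : p_ mu (2 * n).+1 x = \int[mu]_(t in `[0, x]) p_ mu (2 * n) t.
Proof. by rewrite /= oddM. Qed.

Lemma p_evenE n x :
  p_ mu (2 * n.+1) x = \int[lebesgue_measure]_(t in `[0, x]) p_ mu (2 * n).+1 t.
Proof. by rewrite mulnS /= oddM. Qed.

Lemma p_ge0 n x : 0 <= p_ mu n x.
Proof.
elim: n x => [|n IHn] x /=; first exact: ler01.
by case: ifP => _; exact: Rintegral_ge0.
Qed.

Lemma p_1 : p_ mu 1 1 = 1.
Proof. by rewrite /= Rintegral_cst//= mu_01/= mulr1. Qed.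

(** The index [n] and the degree [k] of the bound are kept separate, because integrating against
    [mu] raises only the index. *)
Definition p_regular n k := measurable_fun `[0 : R, 1] (p_ mu n) /\
  forall x, x \in `[0, 1] -> `|p_ mu n x| <= exp_coeff x k.

Lemma p_regular_integrable (nu : {measure set (measurableTypeR R) -> \bar R}) n k :
  nu `[0 : R, 1]%classic = 1%E -> p_regular n k ->
  nu.-integrable `[0 : R, 1] (EFin \o p_ mu n).
Proof.
move=> nu1 [mp pk]; apply: (@bounded_integrable01 _ _ nu1 _ (exp_coeff 1 k)) => // x x01.
apply: le_trans (pk _ x01) _.
by move: x01; rewrite in_itv/= => /andP[x0 x1]; exact: le_exp_coeff.
Qed.

Lemma p_odd_regular n : p_regular (2 * n) n -> p_regular (2 * n).+1 n.
Proof.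
move=> pn; have ip := p_regular_integrable mu_01 pn.
split=> [|x x01].
  rewrite (_ : p_ mu _ = fun x => \int[mu]_(t in `[0, x]) p_ mu (2 * n) t).
    exact: measurable_Rintegral_itv0.
  by apply/funext => x; exact: p_oddE.
rewrite p_oddE -[leRHS]mul1r; apply: Rintegral_itv0_exp_coeff_le => // t t01.
by rewrite mul1r; exact: pn.2.
Qed.

(** Passing from 2n to 2n + 2 takes one [mu]-integral, which keeps the degree of the bound, and one
    Lebesgue integral, which raises it by one. *)
Lemma p_even_regular n : p_regular (2 * n) n.
Proof.
elim: n => [|n /p_odd_regular pn].
  split=> [|x _ /=]; first exact: measurable_cst.
  by rewrite /exp_coeff/= normr1 expr0 fact0 divr1.
have ip := p_regular_integrable lebesgue_measure_itv01 pn.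
split=> [|x x01].
  rewrite (_ : p_ mu _ = fun x =>
    \int[lebesgue_measure]_(t in `[0, x]) p_ mu (2 * n).+1 t).
    exact: measurable_Rintegral_itv0.
  by apply/funext => x; exact: p_evenE.
rewrite p_evenE -[leRHS]mul1r; apply: lebesgue_itv0_exp_coeff_le => // t t01.
by rewrite mul1r; exact: pn.2.
Qed.

(** * The power series in [L] and their integral equations *)

(* For L = z ^+ 2 these are the terms of c_lambda_mu z and, at x = 1 and up to a
   factor z, of sinN z; in this form they make sense for negative L too. *)
Definition cterm L n x := (- L) ^+ n * p_ mu (2 * n) x.
Definition sterm L n x := (- L) ^+ n * p_ mu (2 * n).+1 x.
Definition csum L x := limn (series (cterm L ^~ x)).
Definition ssum L x := limn (series (sterm L ^~ x)).

(** The majorant is a term of the exponential series at [|L|], uniform in [x], as termwise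
    integration requires. *)
Lemma p_regular_term_le L m n x : p_regular m n -> x \in `[0, 1] ->
  `|(- L) ^+ n * p_ mu m x| <= exp_coeff `|L| n.
Proof.
move=> pm x01; rewrite normrM normrX normrN /exp_coeff/= ler_wpM2l ?exprn_ge0//.
apply: le_trans (pm.2 _ x01) _; move: x01; rewrite in_itv/= => /andP[x0 x1].
by rewrite (le_trans (le_exp_coeff n x0 x1))// /exp_coeff/= expr1n mul1r.
Qed.

Lemma cterm_le L n x : x \in `[0, 1] -> `|cterm L n x| <= exp_coeff `|L| n.
Proof. by move=> x01; apply: p_regular_term_le => //; exact: p_even_regular. Qed.

Lemma sterm_le L n x : x \in `[0, 1] -> `|sterm L n x| <= exp_coeff `|L| n.
Proof.
by move=> x01; apply: p_regular_term_le => //; exact/p_odd_regular/p_even_regular.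
Qed.

Lemma measurable_cterm L n : measurable_fun `[0 : R, 1] (cterm L n).
Proof. by apply: measurable_funM => //; exact: (p_even_regular n).1. Qed.

Lemma measurable_sterm L n : measurable_fun `[0 : R, 1] (sterm L n).
Proof.
by apply: measurable_funM => //; exact: (p_odd_regular (p_even_regular n)).1.
Qed.

Lemma measurable_csum L : measurable_fun `[0 : R, 1] (csum L).
Proof.
exact: (@measurable_limn_series _ _ _ (measurable_cterm L) (cterm_le L)
  (is_cvg_series_exp_coeff `|L|)).
Qed.

Lemma measurable_ssum L : measurable_fun `[0 : R, 1] (ssum L).
Proof.
exact: (@measurable_limn_series _ _ _ (measurable_sterm L) (sterm_le L)
  (is_cvg_series_exp_coeff `|L|)).
Qed.

Lemma csum_le L x : x \in `[0, 1] -> `|csum L x| <= expR `|L|.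
Proof. exact: (@limn_series_le _ _ _ (cterm_le L) (is_cvg_series_exp_coeff `|L|) x). Qed.

Lemma ssum_le L x : x \in `[0, 1] -> `|ssum L x| <= expR `|L|.
Proof. exact: (@limn_series_le _ _ _ (sterm_le L) (is_cvg_series_exp_coeff `|L|) x). Qed.

Lemma cvg_csum L x : x \in `[0, 1] -> series (cterm L ^~ x) @ \oo --> csum L x.
Proof.
move=> x01; apply: dominated_cvg_series (is_cvg_series_exp_coeff `|L|) => n.
exact: cterm_le.
Qed.

Lemma cvg_ssum L x : x \in `[0, 1] -> series (sterm L ^~ x) @ \oo --> ssum L x.
Proof.
move=> x01; apply: dominated_cvg_series (is_cvg_series_exp_coeff `|L|) => n.
exact: sterm_le.
Qed.

Lemma ssumE L x : x \in `[0, 1] -> ssum L x = \int[mu]_(t in `[0, x]) csum L t.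
Proof.
move=> x01; apply: cvg_lim => //.
rewrite (_ : sterm L ^~ x = fun n => \int[mu]_(t in `[0, x]) cterm L n t).
  exact: (@cvg_series_Rintegral _ _ mu_01 _ _ (measurable_cterm L)
    (cterm_le L) (is_cvg_series_exp_coeff `|L|)).
apply/funext => n; rewrite /sterm p_oddE -RintegralZl//.
by apply: integrable_itv0 => //; exact: p_regular_integrable (p_even_regular n).
Qed.

Lemma csumE L x : x \in `[0, 1] ->
  csum L x = 1 - L * \int[lebesgue_measure]_(t in `[0, x]) ssum L t.
Proof.
(* The term of index 0 is 1, and the term of index n + 1 is [- L] times the Lebesgue integral of
   [sterm L n]; hence the shift by one. *)
move=> x01; apply: cvg_lim => //; rewrite -cvg_shiftS/=.
have -> : (fun n : nat => series (cterm L ^~ x) n.+1) =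
    (fun n => 1 - L *
      series (fun n => \int[lebesgue_measure]_(t in `[0, x]) sterm L n t) n).
  apply/funext => n.
  rewrite /series/= big_nat_recl//= {1}/cterm expr0 muln0 mulr1; congr (_ + _).
  rewrite -mulNr mulr_sumr; apply: eq_bigr => i _.
  rewrite /cterm p_evenE exprS -mulrA -RintegralZl//; apply: integrable_itv0 => //.
  exact: p_regular_integrable lebesgue_measure_itv01 (p_odd_regular (p_even_regular i)).
apply: cvgB; first exact: cvg_cst.
apply: cvgMr.
exact: (@cvg_series_Rintegral _ _ lebesgue_measure_itv01 _ _ (measurable_sterm L)
  (sterm_le L) (is_cvg_series_exp_coeff `|L|)).
Qed.

Lemma csum0 L : csum L 0 = 1.
Proof. by rewrite csumE ?itv01_0// set_itv1 Rintegral_set1 mulr0 subr0. Qed.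

Lemma Rintegral_nonatomic_set1 f x : \int[mu]_(t in [set x]) f t = 0.
Proof.
rewrite (@eq_Rintegral _ _ _ mu _ (cst (f x))); last by move=> t /[!inE] ->.
by rewrite Rintegral_cst//= mu_nonatomic mulr0.
Qed.

(** The interval [0, 0] is a single point, null for the non-atomic [mu]. This yields the Neumann
    condition of [csum L] at 0. *)
Lemma ssum0 L : ssum L 0 = 0.
Proof. by rewrite ssumE ?itv01_0// set_itv1 Rintegral_nonatomic_set1. Qed.

(** * Eigenfunctions for a real parameter [L] *)

Lemma bounded_L2_01 (nu : {measure set (measurableTypeR R) -> \bar R}) f M :
  nu `[0 : R, 1]%classic = 1%E -> measurable_fun `[0 : R, 1] f ->
  (forall x, x \in `[0, 1] -> `|f x| <= M) -> L2_01 nu f.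
Proof.
move=> nu1 mf fM; split=> //.
apply: (@bounded_integrable01 _ _ nu1 (fun x => f x ^+ 2) (M ^+ 2)).
  exact: measurable_funX.
by move=> x x01; rewrite normrX lerXn2r ?nnegrE ?fM// (le_trans _ (fM _ x01)).
Qed.

Lemma csum_neumann L : L * ssum L 1 = 0 -> neumann_eigenfunction mu L (csum L).
Proof.
move=> Ls0; split; first by exists 0; rewrite ?itv01_0// csum0 oner_neq0.
exists (fun x => - L * ssum L x); last by rewrite ssum0 mulr0 mulNr Ls0 oppr0.
have bound (F : R -> R) x : `|F x| <= expR `|L| -> `|- L * F x| <= `|L| * expR `|L|.
  by move=> Fx; rewrite normrM normrN ler_wpM2l.
split.
- split.
    apply: (bounded_L2_01 (M := `|L| * expR `|L|) lebesgue_measure_itv01).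
      by apply: measurable_funM => //; exact: measurable_ssum.
    by move=> x x01; exact/bound/ssum_le.
  move=> x x01; rewrite csum0 csumE// -mulNr RintegralZl//.
  apply: integrable_itv0 => //.
  by apply: (bounded_integrable01 lebesgue_measure_itv01 (measurable_ssum L)); exact: ssum_le.
- exists (fun x => - L * csum L x); last exact: aeW.
  split.
    apply: (bounded_L2_01 (M := `|L| * expR `|L|) mu_01).
      by apply: measurable_funM => //; exact: measurable_csum.
    by move=> x x01; exact/bound/csum_le.
  move=> x x01; rewrite ssum0 mulr0 add0r ssumE// RintegralZl//.
  apply: integrable_itv0 => //.
  by apply: (bounded_integrable01 mu_01 (measurable_csum L)); exact: csum_le.
Qed.

(* Iterating the equation n times bounds u by M |L|^n x^n / n!. *)
Lemma double_integral_fixpoint_eq0 L M u : measurable_fun `[0 : R, 1] u ->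
  (forall x, x \in `[0, 1] -> `|u x| <= M) ->
  (forall x, x \in `[0, 1] -> u x = - L *
    \int[lebesgue_measure]_(t in `[0, x]) \int[mu]_(s in `[0, t]) u s) ->
  forall x, x \in `[0, 1] -> u x = 0.
Proof.
move=> mes_u uM uE.
have M0 : 0 <= M by rewrite (le_trans _ (uM _ itv01_0)).
have iu : mu.-integrable `[0 : R, 1] (EFin \o u) by
  exact: (bounded_integrable01 mu_01 mes_u uM).
have iF : lebesgue_measure.-integrable `[0 : R, 1]
    (EFin \o (fun t => \int[mu]_(s in `[0, t]) u s)).
  apply: (bounded_integrable01 lebesgue_measure_itv01
    (measurable_Rintegral_itv0 iu)) => t t01.
  exact: le_normr_Rintegral01.
have uMn n x : x \in `[0, 1] -> `|u x| <= M * `|L| ^+ n * exp_coeff x n.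
  elim: n x => [x x01|n IHn x x01].
    by rewrite /exp_coeff/= !expr0 fact0 divr1 !mulr1 uM.
  rewrite uE// normrM normrN exprS [M * _]mulrCA -[leRHS]mulrA ler_wpM2l//.
  apply: lebesgue_itv0_exp_coeff_le => // t t01.
  by apply: Rintegral_itv0_exp_coeff_le => //; rewrite mulr_ge0 ?exprn_ge0.
move=> x x01; apply/eqP; rewrite -normr_le0.
(* Since [x <= 1], the bound is at most [M] times a term of the exponential series at [|L|], and
   these terms tend to 0. *)
have c0 : M * exp_coeff `|L| n @[n --> \oo] --> 0.
  by rewrite -[X in _ --> X](mulr0 M); apply: cvgMr; exact: cvg_exp_coeff.
rewrite -(cvg_lim _ c0)//; apply: limr_ge; first by apply/cvg_ex; exists 0.
apply: nearW => n; apply: le_trans (uMn n x x01) _.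
rewrite -mulrA ler_wpM2l// [leRHS]/exp_coeff/= ler_wpM2l ?exprn_ge0//.
move: x01; rewrite in_itv/= => /andP[x0 x1].
by rewrite (le_trans (le_exp_coeff n x0 x1))// /exp_coeff/= expr1n mul1r.
Qed.

Lemma neumann_eigenfunctionE L f : neumann_eigenfunction mu L f ->
  f 0 != 0 /\ L * ssum L 1 = 0.
Proof.
move=> [[x1 x101 fx1] [g [[L2g fE] [h [L2h gE] hE]] [g0 g1]]].
have ig := L2_01_integrable lebesgue_measure_itv01 L2g.
pose C := `|f 0| + \int[lebesgue_measure]_(t in `[0, 1]) `|g t|.
have fC x : x \in `[0, 1] -> `|f x| <= C.
  by move=> x01; rewrite fE// (le_trans (ler_normD _ _))// lerD2l le_normr_Rintegral01.
have mf : measurable_fun `[0 : R, 1] f.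
  apply: (eq_measurable_fun (fun x => f 0 + \int[lebesgue_measure]_(t in `[0, x]) g t)).
    by move=> x /[!inE] x01; rewrite (fE x).
  by apply: measurable_funD => //; exact: measurable_Rintegral_itv0.
have if_ : mu.-integrable `[0 : R, 1] (EFin \o f) by
  exact: (bounded_integrable01 mu_01 mf fC).
(* The equation for [h] holds only almost everywhere, but [h] enters through its integrals, so this
   identity holds at every point of [0, 1]. *)
have gE' x : x \in `[0, 1] -> g x = - L * \int[mu]_(t in `[0, x]) f t.
  move=> x01; rewrite gE// g0 add0r -RintegralZl//; last exact: integrable_itv0.
  have sub := @subset_itv01 _ _ x01.
  congr fine; apply: ae_eq_integral => //.
  - by apply/measurable_EFinP; apply: measurable_funS L2h.1.
  - by apply/measurable_EFinP; apply: measurable_funM => //; apply: measurable_funS mf.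
  - by apply: (@filterS _ _ (ae_filter_ringOfSetsType mu) _ _ _ hE)
      => t ht /= tx; rewrite ht//; exact: sub.
(* Subtracting [f 0 * csum L x] cancels the initial value of [f], as [csum L 0 = 1]; the difference
   satisfies the homogeneous double integral equation. *)
have u0 : forall x, x \in `[0, 1] -> f x - f 0 * csum L x = 0.
  have ms := @measurable_csum L.
  have is_ := bounded_integrable01 lebesgue_measure_itv01 (@measurable_ssum L) (@ssum_le L).
  have ic := bounded_integrable01 mu_01 ms (@csum_le L).
  apply: (@double_integral_fixpoint_eq0 L (C + `|f 0| * expR `|L|)
    (fun x => f x - f 0 * csum L x)).
  - by apply: measurable_funB => //; exact: measurable_funM.
  - move=> x x01; rewrite (le_trans (ler_normB _ _))// lerD ?fC//.
    by rewrite normrM ler_wpM2l// csum_le.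
  - move=> x x01; rewrite fE// csumE//.
    have inner t : t \in `[0, x] -> \int[mu]_(s in `[0, t]) (f s - f 0 * csum L s) =
        \int[mu]_(s in `[0, t]) f s - f 0 * ssum L t.
      move=> tx; have t01 : t \in `[0, 1] by exact: subset_itv01 tx.
      rewrite ssumE// -RintegralZl//; last exact: integrable_itv0.
      rewrite RintegralB//; first exact: integrable_itv0.
      exact: (integrableZl _ (f 0) (integrable_itv0 t01 ic)).
    rewrite [in RHS](@eq_Rintegral _ _ _ lebesgue_measure _
      (fun t => \int[mu]_(s in `[0, t]) f s - f 0 * ssum L t)); last first.
      by move=> t /[!inE] tx; exact: inner.
    have iF : lebesgue_measure.-integrable `[0 : R, 1]
        (EFin \o (fun t => \int[mu]_(s in `[0, t]) f s)).
      apply: (bounded_integrable01 lebesgue_measure_itv01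
        (measurable_Rintegral_itv0 if_)) => t t01.
      exact: le_normr_Rintegral01.
    rewrite RintegralB//; first last.
    + exact: (integrableZl _ (f 0) (integrable_itv0 x01 is_)).
    + exact: integrable_itv0.
    rewrite RintegralZl//; last exact: integrable_itv0.
    have -> : \int[lebesgue_measure]_(t in `[0, x]) g t =
        - L * \int[lebesgue_measure]_(t in `[0, x]) \int[mu]_(s in `[0, t]) f s.
      rewrite -RintegralZl//; last exact: integrable_itv0.
      by apply: eq_Rintegral => t /[!inE] tx; rewrite gE'//; exact: subset_itv01 tx.
    by ring.
have fcE x : x \in `[0, 1] -> f x = f 0 * csum L x.
  by move=> /u0/eqP; rewrite subr_eq0 => /eqP.
(* Otherwise [f] would vanish on all of [0, 1], and in particular at [x1]. *)
have f0 : f 0 != 0 by apply: contraNneq fx1 => f0; rewrite fcE// f0 mul0r.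
split=> //; apply/eqP.
(* The left-hand side is [L] times the [mu]-integral of [f] over [0, 1], that is [- g 1]. *)
have : f 0 * (L * ssum L 1) = 0.
  rewrite mulrCA ssumE ?itv01_1// -RintegralZl//; last first.
    exact: (bounded_integrable01 mu_01 (@measurable_csum L) (@csum_le L)).
  under eq_Rintegral => t /[!inE] t01 do rewrite -fcE//.
  by apply/eqP; rewrite -oppr_eq0 -mulNr -gE' ?itv01_1// g1.
by move=> /eqP; rewrite mulf_eq0 (negbTE f0).
Qed.

Lemma neumann_eigenvalueP L : neumann_eigenvalue mu L <-> L * ssum L 1 = 0.
Proof.
split=> [[f /neumann_eigenfunctionE[]//]|Ls0].
by exists (csum L); exact: csum_neumann.
Qed.

Lemma neumann_eigenvalue_ge0 L : neumann_eigenvalue mu L -> 0 <= L.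
Proof.
move=> /neumann_eigenvalueP Ls0; rewrite leNgt; apply/negP => L0.
have s1 : 1 <= ssum L 1.
  apply: limr_ge; first by apply/cvg_ex; exists (ssum L 1); exact/cvg_ssum/itv01_1.
  (* The partial sum of index 0 is empty, so the lower bound 1 holds only from index 1 on. *)
  exists 1%N => // -[//|n] _.
  rewrite /series/= big_nat_recl//= {1}/sterm expr0 mul1r muln0 p_1 lerDl.
  apply: sumr_ge0 => i _; rewrite mulr_ge0 ?p_ge0// exprn_ge0// oppr_ge0 ltW//.
move/eqP: Ls0; rewrite mulf_eq0 (lt_eqF L0)/= => /eqP s0.
by move: s1; rewrite s0 ler10.
Qed.

(** * From the parameter [L] to [z] with [L = z ^+ 2] *)

Lemma c_lambda_muE z x : c_lambda_mu mu z x = csum (z ^+ 2) x.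
Proof.
rewrite /c_lambda_mu /csum; congr (limn (series _)); apply/funext => n.
by rewrite /cterm -[- z ^+ 2]mulN1r [(-1 * _) ^+ n]exprMn exprM.
Qed.

Lemma sinNE z : sinN mu z = z * ssum (z ^+ 2) 1.
Proof.
apply: cvg_lim => //.
have -> : series (fun n => (-1) ^+ n * p_ mu (2 * n).+1 1 * z ^+ (2 * n).+1) =
    (fun n => z * series (sterm (z ^+ 2) ^~ 1) n).
  apply/funext => n; rewrite /series mulr_sumr; apply: eq_bigr => i _.
  by rewrite /sterm -[- z ^+ 2]mulN1r [(-1 * _) ^+ i]exprMn exprS exprM; ring.
by apply: cvgMr; exact/cvg_ssum/itv01_1.
Qed.

(** For [L = z ^+ 2] the characteristic quantity [L * ssum L 1] equals [z * sinN mu z].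
    Nonnegativity of eigenvalues allows the choice [z = Num.sqrt L]. *)
Lemma neumann_eigenvalues_eq_sinN_zeros : [set L : R | neumann_eigenvalue mu L] =
  [set z ^+ 2 | z in [set z : R | 0 <= z /\ sinN mu z = 0]].
Proof.
apply/seteqP; split=> [L /= evL|_ /= [z [z0 sz] <-]].
  have L0 := neumann_eigenvalue_ge0 evL; have := evL => /neumann_eigenvalueP Ls0.
  exists (Num.sqrt L); last exact: sqr_sqrtr.
  split; first exact: sqrtr_ge0.
  apply/eqP; rewrite sinNE sqr_sqrtr// mulf_eq0 sqrtr_eq0.
  (* Either [L = 0], and then its root vanishes, or the factor [ssum L 1] does. *)
  by move/eqP: Ls0; rewrite mulf_eq0 => /orP[/eqP->|->]; rewrite ?lexx ?orbT.
by apply/neumann_eigenvalueP; rewrite expr2 -mulrA -expr2 -sinNE sz mulr0.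
Qed.

Lemma c_lambda_mu_neumann L : neumann_eigenvalue mu L ->
  neumann_eigenfunction mu L (c_lambda_mu mu (Num.sqrt L)) /\
  forall x : R, x \in `[0, 1] -> c_lambda_mu mu (Num.sqrt L) x =
    limn (series (fun n => (-1) ^+ n * L ^+ n * p_ mu (2 * n) x)).
Proof.
move=> evL; have L0 := neumann_eigenvalue_ge0 evL.
have -> : c_lambda_mu mu (Num.sqrt L) = csum L.
  by apply/funext => x; rewrite c_lambda_muE sqr_sqrtr.
split; first exact/csum_neumann/neumann_eigenvalueP.
move=> x _; rewrite /csum; congr (limn (series _)); apply/funext => n.
by rewrite /cterm -[- L]mulN1r exprMn.
Qed.

End NeumannEigenvalues.

Unset Implicit Arguments.

Theorem proposition3p7 (R : realType)
    (mu : probability (measurableTypeR R) R)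
    (mu_01 : mu `[0 : R, 1]%classic = 1%E)
    (mu_nonatomic : forall x : R, mu [set x] = 0%E) :
  [/\ [set L : R | neumann_eigenvalue mu L] =
        [set z ^+ 2 | z in [set z : R | 0 <= z /\ sinN mu z = 0]],
      forall L : R, neumann_eigenvalue mu L ->
        neumann_eigenfunction mu L (c_lambda_mu mu (Num.sqrt L)) /\
        forall x : R, x \in `[0, 1] ->
          c_lambda_mu mu (Num.sqrt L) x =
            limn (series (fun n => (-1) ^+ n * L ^+ n * p_ mu (2 * n) x))
    & forall lam : nat -> R, neumann_sequence mu lam ->
        range lam = [set z ^+ 2 | z in [set z : R | 0 <= z /\ sinN mu z = 0]] /\
        forall m : nat,
          neumann_eigenfunction mu (lam m) (c_lambda_mu mu (Num.sqrt (lam m)))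
          /\ forall x : R, x \in `[0, 1] ->
               c_lambda_mu mu (Num.sqrt (lam m)) x =
                 limn (series (fun n => (-1) ^+ n * lam m ^+ n * p_ mu (2 * n) x))].
Proof.
have evE := neumann_eigenvalues_eq_sinN_zeros mu_01 mu_nonatomic.
split=> // [L|lam [_ lamE]]; first exact: c_lambda_mu_neumann.
split=> [|m]; first by rewrite lamE.
apply: c_lambda_mu_neumann => //.
have : range lam (lam m) by exists m.
by rewrite lamE.
Qed.
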